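(* Let $n\geq1$, let $\lambda_1,\dots,\lambda_n\in\mathbb{D}$, and let $$B(z)=\prod_{i=1}^{n}\frac{z-\lambda_{i}}{1-\overline{\lambda_{i}}z}.$$ Put $\lambda:=\max_{1\le i\le n}|\lambda_i|$, assume $\lambda>0$, and put $\alpha_0:=\frac{1-\lambda}{1+\lambda}$. Let $\alpha\in(0,\alpha_{0})$ and define $$s^{*}:=\frac{\alpha^{-1}-1+(\alpha^{-1}+1)\lambda^{2}}{2\lambda\alpha^{-1}}+\sqrt{\left(\frac{\alpha^{-1}-1+(\alpha^{-1}+1)\lambda^{2}}{2\lambda\alpha^{-1}}\right)^{2}-1}.$$ Then $s^{*}\in(1,1/\lambda)$ and one has $$|\widehat{B}(k)|\leq\left(\frac{b_{\lambda}(s^{*})}{(s^{*})^{k/n}}\right)^{n}<1\qquad\text{for all integers } k\geq\alpha^{-1}n.$$ In particular, $$\sum_{k\geq k_0}|\widehat{B}(k)|^{2}\leq\frac{b_{\lambda}(s^{*})^{2n}}{(s^{*})^{2k_0}}\,\frac{(s^{*})^2}{(s^{*})^2-1}\qquad\text{for all integers } k_0\geq \alpha^{-1}n.$$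
   Context: $\mathbb{D}$ is the open unit disk in $\mathbb{C}$. For $w\in\mathbb{D}$, $b_w(z)=\frac{z-w}{1-\overline{w}z}$ is the elementary Blaschke factor; in particular $b_\lambda(s)=\frac{s-\lambda}{1-\lambda s}$. The Fourier–Taylor coefficients of $B$ are $\widehat{B}(k)=\frac{1}{2\pi i}\oint_{|z|=1}z^{-k-1}B(z)\,dz$, $k\geq0$, i.e. $B(z)=\sum_{k\geq0}\widehat{B}(k)z^k$ on $\mathbb{D}$. *)

(* Defs.v *)
From Stdlib Require Import Reals List RList Lra.
From Coquelicot Require Import Coquelicot.
Open Scope R_scope.

Definition blaschke (w z : C) : C := ((z - w) / (1 - Cconj w * z))%C.

(* Restriction of [blaschke] to real arguments, see [blaschke_RtoC]. *)
Definition blaschke_R (w x : R) : R := (x - w) / (1 - w * x).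

Lemma blaschke_RtoC (w x : R) : 1 - w * x <> 0 ->
  blaschke (RtoC w) (RtoC x) = RtoC (blaschke_R w x).
Proof.
  intros H. unfold blaschke, blaschke_R.
  replace (Cconj (RtoC w)) with (RtoC w)
    by (unfold Cconj, RtoC; simpl; f_equal; ring).
  rewrite RtoC_div, !RtoC_minus, RtoC_mult; trivial.
Qed.

(* Zeros are listed with multiplicity. *)
Definition blaschke_prod (ws : list C) (z : C) : C :=
  fold_right Cmult (RtoC 1) (map (fun w => blaschke w z) ws).

Definition unit_circle (t : R) : C := (cos t, sin t).

(* Contour integral over |z| = 1, counterclockwise, with z = e^(it) and
   dz = i e^(it) dt. *)
Definition circle_int (f : C -> C) : C :=
  RInt (V := C_R_CompleteNormedModule)
    (fun t => (f (unit_circle t) * (Ci * unit_circle t))%C) 0 (2 * PI).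

Definition fourier_coef (f : C -> C) (k : nat) : C :=
  (/ (RtoC (2 * PI) * Ci) * circle_int (fun z => / (z ^ (S k)) * f z))%C.

Definition s_star (lam alpha : R) : R :=
  let c := (/ alpha - 1 + (/ alpha + 1) * lam ^ 2) / (2 * lam * / alpha) in
  c + sqrt (c ^ 2 - 1).

(* Main.v *)
Require Import Defs.
From Stdlib Require Import Reals List RList.
From Coquelicot Require Import Coquelicot.
From Stdlib Require Import Lra Lia.
Open Scope R_scope.

(** The estimate is Cauchy's inequality for [B] on the circle of radius
    [s = s_star lam alpha], where [s] is the radius that makes it best at the
    frequency [k = n / alpha].

    Every zero of [B] has modulus at most [lam], so [B] is holomorphic on
    [|z| < 1 / lam], and for [1 < s < 1 / lam] one has
    [|b_w(z)| <= b_lam(s)] on [|z| = s] ([Cmod_blaschke_le]).  Hence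
    [|B| <= b_lam(s) ^ n] there, and the [k]-th coefficient is at most
    [b_lam(s) ^ n / s ^ k] ([Cmod_fourier_coef_blaschke_prod_le]).  The tail
    of squares is then dominated by a geometric series of ratio [1 / s ^ 2].

    Cauchy's inequality needs the [k]-th Fourier coefficient [J_r(k)] of [B]
    on the circle of radius [r] to satisfy [J_r(k) = r ^ k * J_1(k)]
    ([circle_coef_blaschke_prod_radius]).  No contour deformation is used for
    this.  If [g = b_w * f], then [g = conj w * z * g + z * f - w * f], so the
    coefficients of [g] obey a first-order recurrence in [k], driven by those
    of [f].  If [f] satisfies the radius relation, the defect
    [D(k) = J_r(k) - r ^ k * J_1(k)] of [g] satisfies the homogeneous
    recurrence [D(k) = conj w * r * D(k - 1)] over all integers [k].  It is
    bounded for [k <= 0], because [r >= 1], and [|conj w * r| < 1]; iterating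
    towards [k = -oo] gives [D = 0].  Induction on the list of zeros
    concludes.

    That the bound is below [1] is a one-variable fact: the function
    [x |-> ln (b_lam(x)) - ln x / alpha] vanishes at [1], and the sign of its
    derivative is that of the quadratic whose roots are [s] and [1 / s], so it
    decreases on [[1, s]] ([ln_blaschke_R_s_star]). *)

(** * The optimal radius *)

(** [s_star lam alpha] is the larger root of [x ^ 2 - 2 * c * x + 1], whose
    two roots are inverse to each other.  The last claim is the negativity of
    this quadratic between its roots, in the form in which it enters the
    derivative of [ln (blaschke_R lam x) - ln x / alpha]; the hypothesis
    [alpha < (1 - lam) / (1 + lam)] is exactly [1 < c]. *)
Lemma s_star_spec (lam alpha : R) :
  0 < lam < 1 -> 0 < alpha < (1 - lam) / (1 + lam) ->
  let s := s_star lam alpha in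
  1 < s /\ lam * s < 1 /\
  forall x, 1 < x < s ->
    (1 - lam ^ 2) * (alpha * x) < (x - lam) * (1 - lam * x).
Proof.
  intros Hl Ha s.
  assert (Ha' : alpha * (1 + lam) < 1 - lam).
  { apply Rmult_lt_reg_r with (/ (1 + lam)).
    - apply Rinv_0_lt_compat; lra.
    - rewrite Rmult_assoc, Rinv_r, Rmult_1_r; [apply Ha | lra]. }
  set (c := ((1 - alpha) + (1 + alpha) * lam ^ 2) / (2 * lam)).
  assert (Hc : 2 * lam * c = (1 - alpha) + (1 + alpha) * lam ^ 2)
    by (unfold c; field; lra).
  assert (Hs : s = c + sqrt (c ^ 2 - 1)).
  { unfold s, s_star; cbv zeta.
    replace ((/ alpha - 1 + (/ alpha + 1) * lam ^ 2) / (2 * lam * / alpha))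
      with c by (unfold c; field; lra).
    reflexivity. }
  assert (Hc1 : 1 < c) by nra.
  assert (Hq : sqrt (c ^ 2 - 1) * sqrt (c ^ 2 - 1) = c ^ 2 - 1)
    by (apply sqrt_sqrt; nra).
  pose proof (sqrt_pos (c ^ 2 - 1)) as Hp.
  assert (Hs1 : 1 < s) by lra.
  assert (Hprod : s * (2 * c - s) = 1) by (rewrite Hs; nra).
  (* [2 * c - s] is the other root of the quadratic, namely [/ s]. *)
  assert (Hs' : 2 * c - s < 1) by nra.
  split; [exact Hs1 | split].
  (* The quadratic is positive at [1 / lam], which thus lies beyond [s]. *)
  - assert (H : 0 < (1 - lam * s) * (1 - lam * (2 * c - s))).
    { replace ((1 - lam * s) * (1 - lam * (2 * c - s)))
        with (1 - 2 * lam * c + lam ^ 2 * (s * (2 * c - s))) by ring.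
      rewrite Hprod, Hc. nra. }
    assert (0 < 1 - lam * (2 * c - s)) by nra.
    nra.
  - intros x [Hx1 Hx].
    assert (H : (x - s) * (x - (2 * c - s)) < 0) by nra.
    replace ((x - s) * (x - (2 * c - s)))
      with (x ^ 2 - 2 * c * x + s * (2 * c - s)) in H by ring.
    rewrite Hprod in H.
    assert (lam * (x ^ 2 - 2 * c * x + 1) < 0) by nra.
    nra.
Qed.

Lemma blaschke_R_pos (lam x : R) :
  0 < lam < 1 -> 1 <= x -> lam * x < 1 -> 0 < blaschke_R lam x.
Proof.
  intros Hl Hx Hlx. unfold blaschke_R.
  apply Rdiv_lt_0_compat; lra.
Qed.

(** Mean value theorem on [[1, s]] for [ln (blaschke_R lam x) - ln x / alpha],
    which is [0] at [1] and decreasing up to its critical point [s]. *)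
Lemma ln_blaschke_R_s_star (lam alpha : R) :
  0 < lam < 1 -> 0 < alpha < (1 - lam) / (1 + lam) ->
  ln (blaschke_R lam (s_star lam alpha)) < / alpha * ln (s_star lam alpha).
Proof.
  intros Hl Ha.
  destruct (s_star_spec lam alpha Hl Ha) as (Hs1 & Hls & Hdec).
  set (s := s_star lam alpha) in *.
  destruct (MVT_cor2 (fun x => ln (blaschke_R lam x) - / alpha * ln x)
    (fun x => (1 - lam ^ 2) / ((x - lam) * (1 - lam * x)) - / alpha * / x)
    1 s Hs1) as (c & Hc & Hc1).
  - intros x Hx.
    assert (Hlx : lam * x < 1).
    { apply Rle_lt_trans with (lam * s); [apply Rmult_le_compat_l |]; lra. }
    assert (Hb := blaschke_R_pos lam x Hl (proj1 Hx) Hlx).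
    apply is_derive_Reals. unfold blaschke_R in *.
    auto_derive; [repeat split; lra || exact Hb |].
    field; repeat split; lra.
  - assert (Hlc : lam * c < 1).
    { apply Rle_lt_trans with (lam * s); [apply Rmult_le_compat_l |]; lra. }
    assert (H1 : blaschke_R lam 1 = 1) by (unfold blaschke_R; field; lra).
    rewrite H1, ln_1 in Hc.
    assert (Hd := Hdec c Hc1).
    assert (Hneg : (1 - lam ^ 2) / ((c - lam) * (1 - lam * c)) < / alpha * / c).
    { assert (0 < (c - lam) * (1 - lam * c)) by nra.
      assert (0 < alpha * c) by nra.
      rewrite <- Rinv_mult.
      apply Rmult_lt_reg_r with ((c - lam) * (1 - lam * c)); [lra |].
      unfold Rdiv. rewrite Rmult_assoc, Rinv_l by lra.
      apply Rmult_lt_reg_l with (alpha * c); [lra |].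
      replace (alpha * c * (/ (alpha * c) * ((c - lam) * (1 - lam * c))))
        with ((c - lam) * (1 - lam * c)) by (field; lra).
      lra. }
    nra.
Qed.

(** * Blaschke products on a circle outside the unit disk *)

(** From [|z - w| ^ 2 = |1 - conj w * z| ^ 2 + (s ^ 2 - 1) * (1 - |w| ^ 2)],
    the modulus of [blaschke w z] for fixed [|z| = s > 1] and [|w| = m] is
    largest when [|1 - conj w * z|] takes its least value [1 - m * s], that is
    when [z] points in the direction of [w].  The resulting value
    [(s - m) / (1 - m * s)] increases with [m]. *)
Lemma Cmod_blaschke_le (lam s : R) (w z : C) :
  Cmod w <= lam -> Cmod z = s -> 1 < s -> lam * s < 1 ->
  Cmod (blaschke w z) <= blaschke_R lam s.
Proof.
  intros Hw Hz Hs Hls.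
  pose proof (Cmod_ge_0 w) as Hw0.
  assert (HwC := Cmod2_alt w). assert (HzC := Cmod2_alt z).
  rewrite Hz in HzC.
  set (m := Cmod w) in *.
  assert (HX : (1 - m * s) <= Cmod (1 - Cconj w * z)%C).
  { replace (1 - m * s) with (Cmod 1 - Cmod (Cconj w * z)%C)
      by (rewrite Cmod_1, Cmod_mult, Cmod_conj, Hz; reflexivity).
    pose proof (Cmod_triangle (1 - Cconj w * z)%C (Cconj w * z)%C) as H.
    replace (1 - Cconj w * z + Cconj w * z)%C with (RtoC 1) in H by ring.
    lra. }
  assert (Hms : m * s < 1) by nra.
  assert (Hid : Cmod (z - w)%C ^ 2 =
    Cmod (1 - Cconj w * z)%C ^ 2 + (s ^ 2 - 1) * (1 - m ^ 2)).
  { rewrite !Cmod2_alt, HzC, HwC.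
    unfold Cminus, Cplus, Cmult, Copp, Cconj, Re, Im; simpl. ring. }
  assert (Hne : (1 - Cconj w * z)%C <> 0).
  { intros H. rewrite H, Cmod_0 in HX. lra. }
  unfold blaschke. rewrite Cmod_div by exact Hne.
  set (X := Cmod (1 - Cconj w * z)%C) in *.
  set (Y := Cmod (z - w)%C) in *.
  assert (HY : 0 <= Y) by apply Cmod_ge_0.
  unfold blaschke_R.
  assert (Hmain : Y * (1 - lam * s) <= (s - lam) * X).
  { apply Rsqr_incr_0; [| apply Rmult_le_pos; lra | apply Rmult_le_pos; nra].
    unfold Rsqr.
    assert (H1 : (1 - m ^ 2) * (1 - lam * s) ^ 2
                 <= (1 - lam ^ 2) * (1 - m * s) ^ 2).
    (* The two sides differ by the product whose sign is asserted next. *)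
    { assert (0 <= (lam - m) * ((s - m) * (1 - lam * s)
                                + (s - lam) * (1 - m * s))).
      { apply Rmult_le_pos; [lra |].
        apply Rplus_le_le_0_compat; apply Rmult_le_pos; nra. }
      nra. }
    assert (H2 : (1 - m * s) ^ 2 <= X ^ 2) by (apply pow_incr; lra).
    assert (H3 : 0 <= 1 - lam ^ 2) by nra.
    assert (H4 : (1 - m ^ 2) * (1 - lam * s) ^ 2 <= (1 - lam ^ 2) * X ^ 2).
    { apply Rle_trans with (1 := H1).
      apply Rmult_le_compat_l; assumption. }
    assert (H5 : 0 <= s ^ 2 - 1) by nra.
    assert (H6 := Rmult_le_compat_l _ _ _ H5 H4).
    replace (Y * (1 - lam * s) * (Y * (1 - lam * s)))
      with (Y ^ 2 * (1 - lam * s) ^ 2) by ring.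
    rewrite Hid. nra. }
  apply Rmult_le_reg_r with (X * (1 - lam * s)); [apply Rmult_lt_0_compat; lra |].
  replace (Y / X * (X * (1 - lam * s))) with (Y * (1 - lam * s)) by (field; lra).
  replace ((s - lam) / (1 - lam * s) * (X * (1 - lam * s)))
    with ((s - lam) * X) by (field; lra).
  exact Hmain.
Qed.

Lemma Cmod_blaschke_prod_le (lam s : R) (ws : list C) (z : C) :
  (forall w, In w ws -> Cmod w <= lam) -> Cmod z = s -> 1 < s -> lam * s < 1 ->
  Cmod (blaschke_prod ws z) <= blaschke_R lam s ^ length ws.
Proof.
  intros Hws Hz Hs Hls. induction ws as [| w ws IH].
  - unfold blaschke_prod; simpl. rewrite Cmod_1. lra.
  - change (blaschke_prod (w :: ws) z)
      with (blaschke w z * blaschke_prod ws z)%C.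
    rewrite Cmod_mult. simpl.
    apply Rmult_le_compat; try apply Cmod_ge_0.
    + apply Cmod_blaschke_le; try assumption. apply Hws; left; reflexivity.
    + apply IH. intros w' Hw'. apply Hws; right; exact Hw'.
Qed.

(** * Integrals of complex-valued functions of a real variable *)

Definition C_continuous (h : R -> C) : Prop :=
  forall t, continuous (U := C_R_NormedModule) h t.

(** Continuity for the product topology is tested on real and imaginary
    parts, which reduces products and inverses to real calculus. *)
Lemma C_continuous_pair (h : R -> C) :
  (forall t, continuous (fun x => fst (h x)) t) ->
  (forall t, continuous (fun x => snd (h x)) t) -> C_continuous h.
Proof.
  intros H1 H2 t.
  apply continuous_ext with (fun x => (fst (h x), snd (h x))).
  { intros x; symmetry; apply surjective_pairing. }
  apply (continuous_comp_2 (fun x => fst (h x)) (fun x => snd (h x))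
           (fun x y : R => (x, y))); [apply H1 | apply H2 |].
  apply continuous_ext with (fun z : R * R => z); [intros []; reflexivity |].
  apply continuous_id.
Qed.

Lemma C_continuous_ext (f g : R -> C) :
  (forall t, f t = g t) -> C_continuous f -> C_continuous g.
Proof.
  intros E Hf t. apply (continuous_ext f); [exact E | apply Hf].
Qed.

Lemma C_continuous_fst (h : R -> C) (t : R) :
  C_continuous h -> continuous (fun x => fst (h x)) t.
Proof.
  intros H. apply (continuous_comp h (@fst R R)); [apply H |].
  apply (@continuous_fst R_UniformSpace R_UniformSpace).
Qed.

Lemma C_continuous_snd (h : R -> C) (t : R) :
  C_continuous h -> continuous (fun x => snd (h x)) t.
Proof.
  intros H. apply (continuous_comp h (@snd R R)); [apply H |].
  apply (@continuous_snd R_UniformSpace R_UniformSpace).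
Qed.

Lemma C_continuous_const (c : C) : C_continuous (fun _ => c).
Proof. intros t. apply continuous_const. Qed.

Lemma C_continuous_plus (f g : R -> C) :
  C_continuous f -> C_continuous g -> C_continuous (fun t => f t + g t)%C.
Proof.
  intros Hf Hg t.
  apply (continuous_plus (V := C_R_NormedModule) f g); [apply Hf | apply Hg].
Qed.

Lemma C_continuous_opp (f : R -> C) :
  C_continuous f -> C_continuous (fun t => - f t)%C.
Proof.
  intros Hf t. apply (continuous_opp (V := C_R_NormedModule) f), Hf.
Qed.

Lemma C_continuous_mult (f g : R -> C) :
  C_continuous f -> C_continuous g -> C_continuous (fun t => f t * g t)%C.
Proof.
  intros Hf Hg.
  pose proof (fun t => C_continuous_fst f t Hf) as F1.
  pose proof (fun t => C_continuous_snd f t Hf) as F2.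
  pose proof (fun t => C_continuous_fst g t Hg) as G1.
  pose proof (fun t => C_continuous_snd g t Hg) as G2.
  apply C_continuous_pair; intros t; simpl.
  - apply (continuous_minus (V := R_NormedModule)
             (fun x => fst (f x) * fst (g x)) (fun x => snd (f x) * snd (g x)));
      apply (continuous_mult (K := R_AbsRing)); auto.
  - apply (continuous_plus (V := R_NormedModule)
             (fun x => fst (f x) * snd (g x)) (fun x => snd (f x) * fst (g x)));
      apply (continuous_mult (K := R_AbsRing)); auto.
Qed.

Lemma C_continuous_inv (f : R -> C) :
  C_continuous f -> (forall t, f t <> 0) -> C_continuous (fun t => / f t)%C.
Proof.
  intros Hf Hne.
  pose proof (fun t => C_continuous_fst f t Hf) as F1.
  pose proof (fun t => C_continuous_snd f t Hf) as F2.
  assert (Hinv : forall t,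
    continuous (fun x => / (fst (f x) ^ 2 + snd (f x) ^ 2)) t).
  { intros t. apply continuous_comp.
    - simpl.
      apply (continuous_plus (V := R_NormedModule)
        (fun x => fst (f x) * (fst (f x) * 1))
        (fun x => snd (f x) * (snd (f x) * 1)));
      repeat apply (continuous_mult (K := R_AbsRing)); auto;
      apply continuous_const.
    - apply continuous_Rinv. intros H. apply (Hne t).
      apply Cmod_eq_0. unfold Cmod. rewrite H. apply sqrt_0. }
  apply C_continuous_pair; intros t; simpl; unfold Rdiv.
  - apply (continuous_mult (K := R_AbsRing) (fun x => fst (f x))
      (fun x => / (fst (f x) ^ 2 + snd (f x) ^ 2))); [auto | exact (Hinv t)].
  - apply (continuous_mult (K := R_AbsRing) (fun x => - snd (f x))
      (fun x => / (fst (f x) ^ 2 + snd (f x) ^ 2))); [| exact (Hinv t)].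
    apply (continuous_opp (V := R_NormedModule)); auto.
Qed.

Notation CRInt := (RInt (V := C_R_CompleteNormedModule)).

Lemma C_continuous_ex_RInt (h : R -> C) (a b : R) :
  C_continuous h -> ex_RInt (V := C_R_CompleteNormedModule) h a b.
Proof.
  intros Hh. apply (ex_RInt_continuous (V := C_R_CompleteNormedModule)).
  intros z _. apply Hh.
Qed.

Lemma CRInt_pair (h : R -> C) (a b : R) :
  C_continuous h ->
  CRInt h a b = (RInt (fun t => fst (h t)) a b, RInt (fun t => snd (h t)) a b).
Proof.
  intros Hh. 
  apply (is_RInt_unique (V := C_R_CompleteNormedModule)).
  apply is_RInt_fct_extend_pair;
   apply (RInt_correct (V:=R_CompleteNormedModule));
   apply (ex_RInt_continuous (V:=R_CompleteNormedModule)); intros z _.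
  - apply C_continuous_fst, Hh.
  - apply C_continuous_snd, Hh.
Qed.

Lemma CRInt_plus (f g : R -> C) (a b : R) :
  C_continuous f -> C_continuous g ->
  CRInt (fun t => f t + g t)%C a b = (CRInt f a b + CRInt g a b)%C.
Proof.
  intros Hf Hg.
  apply (RInt_plus (V := C_R_CompleteNormedModule));
    apply C_continuous_ex_RInt; assumption.
Qed.

(** The integral takes values in a real normed module, whose linearity lemmas
    only cover real scalars; the complex case goes through the components. *)
Lemma CRInt_mult_l (c : C) (f : R -> C) (a b : R) :
  C_continuous f -> CRInt (fun t => c * f t)%C a b = (c * CRInt f a b)%C.
Proof.
  intros Hf.
  rewrite !CRInt_pair by
    (try apply C_continuous_mult; try apply C_continuous_const; assumption).
  assert (E1 : ex_RInt (fun t => fst (f t)) a b)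
    by (apply (ex_RInt_continuous (V:=R_CompleteNormedModule)); intros z _;
        apply C_continuous_fst, Hf).
  assert (E2 : ex_RInt (fun t => snd (f t)) a b)
    by (apply (ex_RInt_continuous (V:=R_CompleteNormedModule)); intros z _;
        apply C_continuous_snd, Hf).
  assert (S : forall (x : R) (h : R -> R), ex_RInt h a b ->
     ex_RInt (fun t => x * h t) a b /\
     RInt (fun t => x * h t) a b = x * RInt h a b).
  { intros x h Hh. split.
    - apply (ex_RInt_scal (V := R_NormedModule) h a b x Hh).
    - apply (RInt_scal (V := R_CompleteNormedModule) h a b x Hh). }
  unfold Cmult; simpl. f_equal.
  - rewrite (RInt_minus (V := R_CompleteNormedModule)
      (fun t => fst c * fst (f t)) (fun t => snd c * snd (f t)))
      by (apply S; assumption).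
    rewrite !(fun x h H => proj2 (S x h H)) by assumption. reflexivity.
  - rewrite (RInt_plus (V := R_CompleteNormedModule)
      (fun t => fst c * snd (f t)) (fun t => snd c * fst (f t)))
      by (apply S; assumption).
    rewrite !(fun x h H => proj2 (S x h H)) by assumption. reflexivity.
Qed.

Lemma C_continuous_Cmod (f : R -> C) (t : R) :
  C_continuous f -> continuous (fun x => Cmod (f x)) t.
Proof.
  intros Hf.
  apply continuous_ext with (fun x => norm (V := C_R_NormedModule) (f x)).
  { intros x. symmetry. apply Cmod_norm. }
  apply (continuous_comp f (norm (V := C_R_NormedModule))); [apply Hf |].
  apply (filterlim_norm (V := C_R_NormedModule)).
Qed.

Lemma Cmod_CRInt_le (f : R -> C) (a b : R) :
  a <= b -> C_continuous f ->
  Cmod (CRInt f a b) <= RInt (fun t => Cmod (f t)) a b.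
Proof.
  intros Hab Hf. rewrite Cmod_norm.
  apply (norm_RInt_le (V := C_R_NormedModule) f (fun t => Cmod (f t)) a b).
  - exact Hab.
  - intros x _. right. symmetry. apply Cmod_norm.
  - apply (RInt_correct (V := C_R_CompleteNormedModule)).
    apply C_continuous_ex_RInt, Hf.
  - apply (RInt_correct (V := R_CompleteNormedModule)).
    apply (ex_RInt_continuous (V := R_CompleteNormedModule)); intros z _.
    apply C_continuous_Cmod, Hf.
Qed.

(** * Fourier coefficients on a circle *)

Lemma unit_circle_plus (x y : R) :
  unit_circle (x + y) = (unit_circle x * unit_circle y)%C.
Proof.
  unfold unit_circle, Cmult; simpl. rewrite cos_plus, sin_plus.
  f_equal; ring.
Qed.

Lemma unit_circle_0 : unit_circle 0 = 1.
Proof. unfold unit_circle. rewrite cos_0, sin_0. reflexivity. Qed.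

Lemma Cmod_unit_circle (t : R) : Cmod (unit_circle t) = 1.
Proof.
  unfold Cmod, unit_circle; simpl fst; simpl snd.
  rewrite <- !Rsqr_pow2, Rplus_comm, sin2_cos2. apply sqrt_1.
Qed.

Lemma unit_circle_inv_pow (t : R) (m : nat) :
  (/ unit_circle t ^ m)%C = unit_circle (- INR m * t).
Proof.
  assert (Hpow : (unit_circle t ^ m)%C = unit_circle (INR m * t)).
  { induction m as [| m IH].
    - simpl Cpow. simpl INR. rewrite Rmult_0_l, unit_circle_0. reflexivity.
    - rewrite Cpow_S, IH, <- unit_circle_plus, S_INR. f_equal; ring. }
  assert (Hne : unit_circle (INR m * t) <> 0).
  { apply Cmod_gt_0. rewrite Cmod_unit_circle. lra. }
  rewrite Hpow, <- (Cmult_1_l (/ _)), <- unit_circle_0.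
  replace 0 with (- INR m * t + INR m * t) by ring.
  rewrite unit_circle_plus. field. exact Hne.
Qed.

Lemma unit_circle_continuous (a : R) : C_continuous (fun t => unit_circle (a * t)).
Proof.
  apply C_continuous_pair; intros t; simpl.
  - apply (ex_derive_continuous (fun x => cos (a * x))). auto_derive. exact I.
  - apply (ex_derive_continuous (fun x => sin (a * x))). auto_derive. exact I.
Qed.

Lemma circle_param_continuous (r : R) : C_continuous (fun t => r * unit_circle t)%C.
Proof.
  apply C_continuous_mult; [apply C_continuous_const |].
  apply (C_continuous_ext (fun t => unit_circle (1 * t))).
  - intros t. rewrite Rmult_1_l. reflexivity.
  - apply unit_circle_continuous.
Qed.

Definition circle_continuous (f : C -> C) (r : R) : Prop :=
  C_continuous (fun t => f (r * unit_circle t)%C).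

(** [2 * PI * r ^ k] times the [k]-th Laurent coefficient of [f].  Negative [k]
    are included because [bounded_backward_recurrence_0] runs to [-oo]. *)
Definition circle_coef (f : C -> C) (r : R) (k : Z) : C :=
  CRInt (fun t => f (r * unit_circle t)%C * unit_circle (- IZR k * t))%C
    0 (2 * PI).

(** With [z = e ^ (i t)], the contour integrand [z ^ (- k - 1) * f z * dz] is
    [i * f z * e ^ (- i k t) * dt]. *)
Lemma fourier_coef_circle_coef (f : C -> C) (k : nat) :
  circle_continuous f 1 ->
  fourier_coef f k = (/ RtoC (2 * PI) * circle_coef f 1 (Z.of_nat k))%C.
Proof.
  intros Hf. unfold fourier_coef, circle_int.
  pose proof PI_RGT_0 as Hpi.
  rewrite (RInt_ext (V := C_R_CompleteNormedModule) _
   (fun t => Ci * (f (1 * unit_circle t) * unit_circle (- IZR (Z.of_nat k) * t)))%C).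
  2: { intros t _. rewrite unit_circle_inv_pow, Cmult_1_l, <- INR_IZR_INZ.
       replace (- INR k * t) with (- INR (S k) * t + t)
         by (rewrite S_INR; ring).
       rewrite unit_circle_plus.
       match goal with |- ?a = ?b => change (@eq C a b) end. ring. }
  rewrite CRInt_mult_l
    by (apply C_continuous_mult; [exact Hf | apply unit_circle_continuous]).
  unfold circle_coef. field. split.
  - intros H. injection H. lra.
  - intros H. injection H. lra.
Qed.

Lemma circle_coef_ext (f g : C -> C) (r : R) (k : Z) :
  (forall z, Cmod z = Rabs r -> f z = g z) ->
  circle_coef f r k = circle_coef g r k.
Proof.
  intros H. apply (RInt_ext (V := C_R_CompleteNormedModule)). intros t _.
  rewrite H; [reflexivity |].
  rewrite Cmod_mult, Cmod_R, Cmod_unit_circle. ring.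
Qed.

Lemma circle_coef_plus (f g : C -> C) (r : R) (k : Z) :
  circle_continuous f r -> circle_continuous g r ->
  circle_coef (fun z => f z + g z)%C r k
    = (circle_coef f r k + circle_coef g r k)%C.
Proof.
  intros Hf Hg. unfold circle_coef.
  rewrite <- CRInt_plus
    by (apply C_continuous_mult;
        [assumption | apply unit_circle_continuous]).
  apply (RInt_ext (V := C_R_CompleteNormedModule)). intros t _. 
  apply Cmult_plus_distr_r.
Qed.

Lemma circle_coef_scal (c : C) (f : C -> C) (r : R) (k : Z) :
  circle_continuous f r ->
  circle_coef (fun z => c * f z)%C r k = (c * circle_coef f r k)%C.
Proof.
  intros Hf. unfold circle_coef.
  rewrite <- CRInt_mult_l
    by (apply C_continuous_mult;
        [assumption | apply unit_circle_continuous]).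
  apply (RInt_ext (V := C_R_CompleteNormedModule)). intros t _.
  symmetry. apply Cmult_assoc.
Qed.

Lemma circle_coef_shift (f : C -> C) (r : R) (k : Z) :
  circle_continuous f r ->
  circle_coef (fun z => z * f z)%C r k = (r * circle_coef f r (k - 1))%C.
Proof.
  intros Hf. unfold circle_coef.
  rewrite <- CRInt_mult_l
    by (apply C_continuous_mult;
        [assumption | apply unit_circle_continuous]).
  apply (RInt_ext (V := C_R_CompleteNormedModule)). intros t _.
  rewrite minus_IZR.
  replace (- (IZR k - 1) * t) with (t + - IZR k * t) by ring.
  rewrite unit_circle_plus.
  change ((r * unit_circle t * f (r * unit_circle t) * unit_circle (- IZR k * t))%C
   = (r * (f (r * unit_circle t) * (unit_circle t * unit_circle (- IZR k * t))))%C).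
  ring.
Qed.

Lemma circle_coef_bounded (f : C -> C) (r : R) :
  circle_continuous f r -> exists M, forall k, Cmod (circle_coef f r k) <= M.
Proof.
  intros Hf. exists (RInt (fun t => Cmod (f (r * unit_circle t)%C)) 0 (2 * PI)).
  intros k. pose proof PI_RGT_0 as Hpi.
  eapply Rle_trans; [apply Cmod_CRInt_le |].
  - lra.
  - apply C_continuous_mult; [exact Hf | apply unit_circle_continuous].
  - right. apply RInt_ext. intros t _.
    rewrite Cmod_mult, Cmod_unit_circle. apply Rmult_1_r.
Qed.

Lemma circle_coef_le (f : C -> C) (r M : R) (k : Z) :
  circle_continuous f r -> (forall z, Cmod z = Rabs r -> Cmod (f z) <= M) ->
  Cmod (circle_coef f r k) <= 2 * PI * M.
Proof.
  intros Hf HM. pose proof PI_RGT_0 as Hpi.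
  assert (Hc : C_continuous
    (fun t => f (r * unit_circle t)%C * unit_circle (- IZR k * t))%C)
   by (apply C_continuous_mult; [exact Hf | apply unit_circle_continuous]).
  rewrite Cmod_norm.
  replace (2 * PI * M) with ((2 * PI - 0) * M) by ring.
  apply (norm_RInt_le_const (V := C_R_NormedModule)
    (fun t => f (r * unit_circle t)%C * unit_circle (- IZR k * t))%C).
  - lra.
  - intros t _.
    apply Rle_trans
      with (Cmod (f (r * unit_circle t)%C * unit_circle (- IZR k * t))%C);
      [right; symmetry; apply Cmod_norm |].
    rewrite Cmod_mult, Cmod_unit_circle, Rmult_1_r. apply HM.
    rewrite Cmod_mult, Cmod_R, Cmod_unit_circle. ring.
  - apply (RInt_correct (V := C_R_CompleteNormedModule)).
    apply C_continuous_ex_RInt. exact Hc.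
Qed.

Lemma CRInt_unit_circle_period (k : Z) : k <> 0%Z ->
  CRInt (fun t => unit_circle (- IZR k * t)) 0 (2 * PI) = RtoC 0.
Proof.
  intros Hk. assert (Hk' : IZR k <> 0) by (apply not_0_IZR; exact Hk).
  rewrite CRInt_pair by apply unit_circle_continuous.
  assert (Hsin : sin (IZR k * PI) = 0) by (apply sin_eq_0_1; exists k; reflexivity).
  assert (H1 : sin (- IZR k * (2 * PI)) = 0).
  { replace (- IZR k * (2 * PI)) with (- (2 * (IZR k * PI))) by ring.
    rewrite sin_neg, sin_2a, Hsin. ring. }
  assert (H2 : cos (- IZR k * (2 * PI)) = 1).
  { replace (- IZR k * (2 * PI)) with (- (2 * (IZR k * PI))) by ring.
    rewrite cos_neg, cos_2a_sin, Hsin. ring. }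
  unfold RtoC. f_equal; apply is_RInt_unique; evar_last.
  - apply (is_RInt_derive (fun t => - / IZR k * sin (- IZR k * t))).
    + intros x _. auto_derive; [exact I | simpl; field; exact Hk'].
    + intros x _. apply C_continuous_fst, unit_circle_continuous.
  - cbv beta. rewrite H1, (Rmult_0_r (- IZR k)), sin_0. unfold minus, plus, opp; simpl. ring.
  - apply (is_RInt_derive (fun t => / IZR k * cos (- IZR k * t))).
    + intros x _. auto_derive; [exact I | simpl; field; exact Hk'].
    + intros x _. apply C_continuous_snd, unit_circle_continuous.
  - cbv beta. rewrite H2, (Rmult_0_r (- IZR k)), cos_0. unfold minus, plus, opp; simpl. ring.
Qed.

(** [D k = q ^ m * D (k - m)] for every [m]; the first factor tends to [0] and
    the second stays bounded. *)
Lemma bounded_backward_recurrence_0 (D : Z -> C) (q : C) (M : R) :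
  Cmod q < 1 -> (forall k, D k = (q * D (k - 1)%Z)%C) ->
  (forall k, (k <= 0)%Z -> Cmod (D k) <= M) -> forall k, D k = 0.
Proof.
  intros Hq Hrec Hbd k. pose proof (Cmod_ge_0 q) as Hq0.
  assert (Hiter : forall m : nat, D k = (q ^ m * D (k - Z.of_nat m)%Z)%C).
  { induction m as [| m IH].
    - simpl. rewrite Z.sub_0_r. ring.
    - rewrite IH, Hrec, Cpow_S.
      replace (k - Z.of_nat m - 1)%Z with (k - Z.of_nat (S m))%Z by lia. ring. }
  apply Cmod_eq_0, Rle_antisym; [| apply Cmod_ge_0].
  assert (Hlim : is_lim_seq (fun m => Cmod q ^ m * M) (Finite (0 * M))).
  { apply (is_lim_seq_mult' _ _ 0 M); [| apply is_lim_seq_const].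
    apply is_lim_seq_geom. rewrite Rabs_pos_eq; assumption. }
  rewrite Rmult_0_l in Hlim.
  apply (is_lim_seq_le_loc (fun _ => Cmod (D k)) (fun m => Cmod q ^ m * M)
           (Cmod (D k)) 0); [| apply is_lim_seq_const | exact Hlim].
  exists (Z.to_nat k). intros m Hm.
  rewrite (Hiter m), Cmod_mult, Cmod_pow.
  apply Rmult_le_compat_l; [apply pow_le; exact Hq0 |].
  apply Hbd. lia.
Qed.

(** * Coefficients of a Blaschke product on different circles *)

Lemma blaschke_denominator_ne0 (w z : C) : Cmod w * Cmod z < 1 ->
  (1 - Cconj w * z)%C <> 0.
Proof.
  intros H H0. apply (Rlt_irrefl 1).
  replace 1 with (Cmod (Cconj w * z)%C) at 1.
  - rewrite Cmod_mult, Cmod_conj. exact H.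
  - replace (Cconj w * z)%C with (1 - (1 - Cconj w * z))%C by ring.
    rewrite H0. replace (1 - 0)%C with (RtoC 1) by ring. apply Cmod_1.
Qed.

Lemma blaschke_circle_continuous (w : C) (r : R) :
  0 <= r -> Cmod w * r < 1 -> circle_continuous (blaschke w) r.
Proof.
  intros Hr Hw.
  pose proof (circle_param_continuous r) as Hid.
  unfold circle_continuous, blaschke, Cdiv. apply C_continuous_mult.
  - apply (C_continuous_plus _ (fun _ => - w)%C); [exact Hid |].
    apply C_continuous_const.
  - apply (C_continuous_inv (fun t => 1 - Cconj w * (r * unit_circle t))%C).
    + apply (C_continuous_plus (fun _ => RtoC 1)); [apply C_continuous_const |].
      apply C_continuous_opp.
      apply C_continuous_mult; [apply C_continuous_const | exact Hid].
    + intros t. apply blaschke_denominator_ne0.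
      rewrite Cmod_mult, Cmod_R, Cmod_unit_circle, Rabs_pos_eq by exact Hr.
      lra.
Qed.

Lemma blaschke_prod_circle_continuous (ws : list C) (r : R) :
  0 <= r -> (forall w, In w ws -> Cmod w * r < 1) ->
  circle_continuous (blaschke_prod ws) r.
Proof.
  intros Hr. induction ws as [| w ws IH]; intros Hws.
  - apply (C_continuous_const 1).
  - apply (C_continuous_mult (fun t => blaschke w (r * unit_circle t)%C)
             (fun t => blaschke_prod ws (r * unit_circle t)%C)).
    + apply blaschke_circle_continuous; [exact Hr |].
      apply Hws; left; reflexivity.
    + apply IH. intros w' Hw'. apply Hws; right; exact Hw'.
Qed.

(** Clearing the denominator of [blaschke w] turns [g = blaschke w * f] into
    the functional equation [g = conj w * z * g + (z - w) * f], in which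
    multiplication by [z] shifts the coefficients. *)
Lemma circle_coef_blaschke_mult (w : C) (f : C -> C) (r : R) (k : Z) :
  0 <= r -> Cmod w * r < 1 -> circle_continuous f r ->
  let g := fun z => (blaschke w z * f z)%C in
  circle_coef g r k =
    (Cconj w * (r * circle_coef g r (k - 1))
     + (r * circle_coef f r (k - 1) + - w * circle_coef f r k))%C.
Proof.
  intros Hr Hw Hf g.
  assert (Hg : circle_continuous g r).
  { apply (C_continuous_mult (fun t => blaschke w (r * unit_circle t)%C));
      [apply blaschke_circle_continuous; assumption | exact Hf]. }
  pose proof (circle_param_continuous r) as Hid.
  assert (Hzf : circle_continuous (fun z => z * f z)%C r)
    by (apply (C_continuous_mult (fun t => r * unit_circle t)%C); assumption).
  assert (Hzg : circle_continuous (fun z => z * g z)%C r)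
    by (apply (C_continuous_mult (fun t => r * unit_circle t)%C); assumption).
  assert (Hwf : circle_continuous (fun z => - w * f z)%C r)
    by (apply (C_continuous_mult (fun _ => - w)%C);
        [apply C_continuous_const | assumption]).
  assert (Hwg : circle_continuous (fun z => Cconj w * (z * g z))%C r)
    by (apply (C_continuous_mult (fun _ => Cconj w)%C);
        [apply C_continuous_const | assumption]).
  assert (Hzwf : circle_continuous (fun z => z * f z + - w * f z)%C r)
    by (apply (C_continuous_plus
          (fun t => r * unit_circle t * f (r * unit_circle t))%C); assumption).
  rewrite (circle_coef_ext g
     (fun z => Cconj w * (z * g z) + (z * f z + - w * f z))%C).
  2: { intros z Hz. unfold g, blaschke. field.
       apply blaschke_denominator_ne0. rewrite Hz, Rabs_pos_eq; assumption. }
  rewrite circle_coef_plus by assumption.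
  rewrite (circle_coef_plus (fun z => z * f z)%C) by assumption.
  rewrite (circle_coef_scal (Cconj w)) by assumption.
  rewrite (circle_coef_scal (- w)) by assumption.
  rewrite !circle_coef_shift by assumption.
  reflexivity.
Qed.

Lemma powerRZ_pred (r : R) (k : Z) : r <> 0 ->
  powerRZ r k = r * powerRZ r (k - 1).
Proof.
  intros Hr. replace k with (1 + (k - 1))%Z at 1 by lia.
  rewrite powerRZ_add, powerRZ_1 by exact Hr. reflexivity.
Qed.

Lemma powerRZ_le_1 (r : R) (k : Z) : 1 <= r -> (k <= 0)%Z ->
  0 <= powerRZ r k <= 1.
Proof.
  intros Hr Hk. split; [apply powerRZ_le; lra |].
  replace k with (- Z.of_nat (Z.to_nat (- k)))%Z by lia.
  rewrite powerRZ_neg', <- pow_powerRZ.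
  rewrite <- Rinv_1. apply Rinv_le_contravar; [lra |].
  apply pow_R1_Rle. exact Hr.
Qed.

(** Independence of the Laurent coefficients from the radius.  The recurrence
    of [circle_coef_blaschke_mult] holds on both circles, so the defect of this
    identity satisfies its homogeneous version, and a solution that is bounded
    at [-oo] vanishes. *)
Lemma circle_coef_blaschke_prod_radius (ws : list C) (r : R) (k : Z) :
  1 <= r -> (forall w, In w ws -> Cmod w * r < 1) ->
  circle_coef (blaschke_prod ws) r k
    = (powerRZ r k * circle_coef (blaschke_prod ws) 1 k)%C.
Proof.
  intros Hr. revert k. induction ws as [| w ws IH]; intros k Hws.
  - assert (Hone : forall x, circle_coef (blaschke_prod nil) x k =
      CRInt (fun t => unit_circle (- IZR k * t)) 0 (2 * PI)).
    { intros x. apply (RInt_ext (V := C_R_CompleteNormedModule)). intros t _.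
      apply Cmult_1_l. }
    rewrite !Hone. destruct (Z.eq_dec k 0) as [-> | Hk].
    + simpl powerRZ. rewrite Cmult_1_l. reflexivity.
    + rewrite CRInt_unit_circle_period by exact Hk. ring.
  - assert (Hw : Cmod w * r < 1) by (apply Hws; left; reflexivity).
    assert (Hws' : forall w, In w ws -> Cmod w * r < 1)
      by (intros w' Hw'; apply Hws; right; exact Hw').
    assert (Hone : forall v, Cmod v * r < 1 -> Cmod v * 1 < 1)
      by (intros v Hv; pose proof (Cmod_ge_0 v); nra).
    set (f := blaschke_prod ws) in *.
    assert (Hfr : circle_continuous f r)
      by (apply blaschke_prod_circle_continuous; [lra | assumption]).
    assert (Hf1 : circle_continuous f 1)
      by (apply blaschke_prod_circle_continuous; [lra | auto]).
    change (blaschke_prod (w :: ws)) with (fun z => blaschke w z * f z)%C.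
    set (g := fun z => (blaschke w z * f z)%C).
    assert (Hgr : circle_continuous g r)
      by (apply (blaschke_prod_circle_continuous (w :: ws)); [lra | assumption]).
    assert (Hg1 : circle_continuous g 1)
      by (apply (blaschke_prod_circle_continuous (w :: ws)); [lra | auto]).
    destruct (circle_coef_bounded g r Hgr) as [Mr HMr].
    destruct (circle_coef_bounded g 1 Hg1) as [M1 HM1].
    assert (HD : forall k,
      (circle_coef g r k - powerRZ r k * circle_coef g 1 k)%C = 0).
    { apply bounded_backward_recurrence_0 with (q := (Cconj w * r)%C) (M := Mr + M1).
      - rewrite Cmod_mult, Cmod_conj, Cmod_R, Rabs_pos_eq by lra. exact Hw.
      - intros j. unfold g.
        rewrite (circle_coef_blaschke_mult w f r j) by (assumption || lra).
        rewrite (circle_coef_blaschke_mult w f 1 j) by (auto || lra).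
        rewrite !IH by assumption.
        rewrite (powerRZ_pred r j) by lra. rewrite RtoC_mult. ring.
      - intros j Hj. unfold Cminus.
        eapply Rle_trans; [apply Cmod_triangle |].
        apply Rplus_le_compat; [apply HMr |].
        rewrite Cmod_opp, Cmod_mult, Cmod_R.
        destruct (powerRZ_le_1 r j Hr Hj) as [P0 P1].
        rewrite Rabs_pos_eq by exact P0.
        pose proof (Cmod_ge_0 (circle_coef g 1 j)). specialize (HM1 j). nra. }
    specialize (HD k).
    replace (circle_coef g r k)
     with ((circle_coef g r k - powerRZ r k * circle_coef g 1 k)
           + powerRZ r k * circle_coef g 1 k)%C by ring.
    rewrite HD. ring.
Qed.

(** Cauchy's inequality: the coefficient is read off on [|z| = s], where it
    gains the factor [s ^ k] while the product is at most
    [blaschke_R lam s ^ length ws]. *)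
Lemma Cmod_fourier_coef_blaschke_prod_le (lam s : R) (ws : list C) (k : nat) :
  (forall w, In w ws -> Cmod w <= lam) -> 1 < s -> lam * s < 1 ->
  Cmod (fourier_coef (blaschke_prod ws) k)
    <= blaschke_R lam s ^ length ws / s ^ k.
Proof.
  intros Hle Hs Hls. pose proof PI_RGT_0 as Hpi.
  assert (Hws : forall w, In w ws -> Cmod w * s < 1).
  { intros w Hw. apply Rle_lt_trans with (lam * s); [| exact Hls].
    apply Rmult_le_compat_r; [lra | apply Hle, Hw]. }
  assert (Hws1 : forall w, In w ws -> Cmod w * 1 < 1).
  { intros w Hw. specialize (Hws w Hw). pose proof (Cmod_ge_0 w). nra. }
  rewrite fourier_coef_circle_coef
    by (apply blaschke_prod_circle_continuous; [lra | exact Hws1]).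
  assert (Hrad := circle_coef_blaschke_prod_radius ws s (Z.of_nat k)
                    (Rlt_le _ _ Hs) Hws).
  rewrite <- pow_powerRZ in Hrad.
  assert (Hbound : Cmod (circle_coef (blaschke_prod ws) s (Z.of_nat k))
                   <= 2 * PI * blaschke_R lam s ^ length ws).
  { apply circle_coef_le.
    - apply blaschke_prod_circle_continuous; [lra | exact Hws].
    - intros z Hz. rewrite Rabs_pos_eq in Hz by lra.
      apply Cmod_blaschke_prod_le; assumption. }
  assert (Hsk : 0 < s ^ k) by (apply pow_lt; lra).
  rewrite Hrad, Cmod_mult, Cmod_R, Rabs_pos_eq in Hbound by lra.
  rewrite <- RtoC_inv by lra.
  rewrite Cmod_mult, Cmod_R, Rabs_pos_eq
    by (left; apply Rinv_0_lt_compat; lra).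
  apply Rmult_le_reg_l with (2 * PI * s ^ k); [apply Rmult_lt_0_compat; lra |].
  set (J := Cmod (circle_coef (blaschke_prod ws) 1 (Z.of_nat k))) in *.
  replace (2 * PI * s ^ k * (/ (2 * PI) * J)) with (s ^ k * J) by (field; lra).
  replace (2 * PI * s ^ k * (blaschke_R lam s ^ length ws / s ^ k))
    with (2 * PI * blaschke_R lam s ^ length ws) by (field; lra).
  exact Hbound.
Qed.

Theorem proposition1
  (n : nat) (hn : (1 <= n)%nat)
  (ws : list C) (hlen : length ws = n)
  (hws : forall w : C, In w ws -> Cmod w < 1)
  (lam : R) (hlam : lam = MaxRlist (map Cmod ws)) (hlam0 : 0 < lam)
  (alpha0 : R) (halpha0 : alpha0 = (1 - lam) / (1 + lam))
  (alpha : R) (halpha : 0 < alpha < alpha0)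
  (s : R) (hs : s = s_star lam alpha) :
  (1 < s < 1 / lam) /\
  (forall k : nat, / alpha * INR n <= INR k ->
     Cmod (fourier_coef (blaschke_prod ws) k)
       <= (blaschke_R lam s / Rpower s (INR k / INR n)) ^ n
     /\ (blaschke_R lam s / Rpower s (INR k / INR n)) ^ n < 1) /\
  (forall k0 : nat, / alpha * INR n <= INR k0 ->
     ex_series (fun j : nat =>
       Cmod (fourier_coef (blaschke_prod ws) (k0 + j)) ^ 2) /\
     Series (fun j : nat =>
       Cmod (fourier_coef (blaschke_prod ws) (k0 + j)) ^ 2)
       <= blaschke_R lam s ^ (2 * n) / s ^ (2 * k0) * (s ^ 2 / (s ^ 2 - 1))).
Proof.
  assert (Hle : forall w, In w ws -> Cmod w <= lam).
  { intros w Hw. rewrite hlam. apply MaxRlist_P1, in_map, Hw. }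
  assert (Hlam1 : lam < 1).
  { assert (Hin : In lam (map Cmod ws)).
    { rewrite hlam. apply MaxRlist_P2.
      destruct ws as [| w ws']; [simpl in hlen; lia |].
      exists (Cmod w). left. reflexivity. }
    apply in_map_iff in Hin. destruct Hin as (w & <- & Hw). apply hws, Hw. }
  assert (Hl : 0 < lam < 1) by lra.
  rewrite halpha0 in halpha.
  destruct (s_star_spec lam alpha Hl halpha) as (Hs1 & Hls & _).
  pose proof (ln_blaschke_R_s_star lam alpha Hl halpha) as Hln.
  rewrite <- hs in Hs1, Hls, Hln.
  pose proof (blaschke_R_pos lam s Hl (Rlt_le _ _ Hs1) Hls) as Hb.
  assert (Hn : 0 < INR n) by (apply lt_0_INR; lia).
  assert (Hcoef : forall k, Cmod (fourier_coef (blaschke_prod ws) k)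
                            <= blaschke_R lam s ^ n / s ^ k).
  { intros k. rewrite <- hlen.
    apply Cmod_fourier_coef_blaschke_prod_le; assumption. }
  split; [| split].
  - split; [exact Hs1 |].
    apply Rmult_lt_reg_l with lam; [lra |].
    replace (lam * (1 / lam)) with 1 by (field; lra). exact Hls.
  - intros k Hk.
    assert (Hpow : Rpower s (INR k / INR n) ^ n = s ^ k).
    { rewrite <- Rpower_pow by apply exp_pos.
      rewrite Rpower_mult.
      replace (INR k / INR n * INR n) with (INR k) by (field; lra).
      apply Rpower_pow. lra. }
    assert (Hbase : 0 < blaschke_R lam s / Rpower s (INR k / INR n))
      by (apply Rdiv_lt_0_compat; [exact Hb | apply exp_pos]).
    split.
    + unfold Rdiv at 1. rewrite Rpow_mult_distr, pow_inv, Hpow. apply Hcoef.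
    + apply pow_lt_1_compat; [| lia]. split; [lra |].
      apply Rmult_lt_reg_r with (Rpower s (INR k / INR n)); [apply exp_pos |].
      unfold Rdiv at 1.
      rewrite Rmult_assoc, Rinv_l, Rmult_1_l, Rmult_1_r
        by (apply Rgt_not_eq, exp_pos).
      apply ln_lt_inv; [exact Hb | apply exp_pos |].
      unfold Rpower. rewrite ln_exp.
      apply Rlt_le_trans with (1 := Hln).
      apply Rmult_le_compat_r.
      * rewrite <- ln_1. apply ln_le; lra.
      * apply Rmult_le_reg_r with (INR n); [exact Hn |].
        replace (INR k / INR n * INR n) with (INR k) by (field; lra).
        exact Hk.
  - intros k0 _.
    set (K := blaschke_R lam s ^ (2 * n) / s ^ (2 * k0)).
    assert (Hs2 : 1 < s ^ 2) by nra.
    assert (Hq : Rabs (/ s ^ 2) < 1).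
    { rewrite Rabs_pos_eq by (left; apply Rinv_0_lt_compat; lra).
      rewrite <- Rinv_1. apply Rinv_lt_contravar; lra. }
    assert (Hterm : forall j,
      0 <= Cmod (fourier_coef (blaschke_prod ws) (k0 + j)) ^ 2
        <= K * (/ s ^ 2) ^ j).
    { intros j. split; [apply pow2_ge_0 |].
      replace (K * (/ s ^ 2) ^ j)
        with ((blaschke_R lam s ^ n / s ^ (k0 + j)) ^ 2).
      - apply pow_incr. split; [apply Cmod_ge_0 | apply Hcoef].
      - unfold K. rewrite pow_inv, <- pow_mult.
        rewrite (Nat.mul_comm 2 n), (Nat.mul_comm 2 k0), (Nat.mul_comm 2 j).
        rewrite !pow_mult, pow_add.
        field. split; apply pow_nonzero; lra. }
    assert (Hgeom : ex_series (fun j => K * (/ s ^ 2) ^ j))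
      by (apply (ex_series_scal (V := R_NormedModule) K), ex_series_geom, Hq).
    split.
    + apply (ex_series_le (V := R_CompleteNormedModule)) with (2 := Hgeom).
      intros j. unfold norm; simpl. unfold abs; simpl.
      rewrite Rabs_pos_eq; apply (Hterm j).
    + eapply Rle_trans; [apply Series_le; [exact Hterm | exact Hgeom] |].
      rewrite Series_scal_l, Series_geom by exact Hq.
      right. f_equal. field. split; lra.
Qed.
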